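(* Let $\mathfrak{a}\subseteq L$ be an ideal and let $\sigma\colon L\to\mathbb{K}$ be a $\mathbb{K}$-linear map with $\mathfrak{a}\subseteq\ker\sigma$. Then the $\mathbb{K}$-linear map $$H\colon R\to \mathrm{Hom}^{\mathrm{semi}}_{\mathbb{K}}(R,\mathbb{K}),\qquad p\mapsto\bigl(q\mapsto\langle q,p\rangle_\sigma\bigr),$$ factors as $$R\xrightarrow{\ \pi_{\mathfrak{a}}\ } R/(\mathfrak{a}\cap R)\longrightarrow \mathrm{Hom}^{\mathrm{semi}}_{\mathbb{K}}\bigl(R/(\mathfrak{a}^{\circ}\cap R),\mathbb{K}\bigr)\xrightarrow{\ \pi_{\mathfrak{a}^{\circ}}^{\top}\ }\mathrm{Hom}^{\mathrm{semi}}_{\mathbb{K}}(R,\mathbb{K}),$$ where the middle map is $p+\mathfrak{a}\cap R\mapsto\bigl(q+\mathfrak{a}^{\circ}\cap R\mapsto\langle q,p\rangle_\sigma\bigr)$ and $\pi_{\mathfrak{a}^{\circ}}^{\top}(\varphi)=\varphi\circ\pi_{\mathfrak{a}^{\circ}}$ for $\varphi\in\mathrm{Hom}^{\mathrm{semi}}_{\mathbb{K}}(R/(\mathfrak{a}^{\circ}\cap R),\mathbb{K})$. Moreover, for all $d,\delta\in\mathbb{N}$, the truncated map between finite-dimensional vector spaces $$H_{d+\delta,d}\colon R_{\le d}\to\mathrm{Hom}^{\mathrm{semi}}_{\mathbb{K}}(R_{\le d+\delta},\mathbb{K}),\qquad p\mapsto\bigl(q\mapsto\langle q,p\rangle_\sigma\bigr),$$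 factors as $H_{d+\delta,d}=\pi_{\mathfrak{a}^{\circ},\le d+\delta}^{\top}\circ\overline{H_{d+\delta,d}}\circ\pi_{\mathfrak{a},\le d}$, where $$\overline{H_{d+\delta,d}}\colon R_{\le d}/(\mathfrak{a}\cap R_{\le d})\to\mathrm{Hom}^{\mathrm{semi}}_{\mathbb{K}}\bigl(R_{\le d+\delta}/(\mathfrak{a}^{\circ}\cap R_{\le d+\delta}),\mathbb{K}\bigr),\qquad p+\mathfrak{a}\cap R_{\le d}\mapsto\bigl(q+\mathfrak{a}^{\circ}\cap R_{\le d+\delta}\mapsto\langle q,p\rangle_\sigma\bigr),$$ and $\pi_{\mathfrak{a}^{\circ},\le d+\delta}^{\top}(\varphi)=\varphi\circ\pi_{\mathfrak{a}^{\circ},\le d+\delta}$.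
   Context: An involution on a ring $A$ is a map $a\mapsto a^{\circ}$ with $(a+b)^{\circ}=a^{\circ}+b^{\circ}$, $(ab)^{\circ}=b^{\circ}a^{\circ}$, $1^{\circ}=1$, $(a^{\circ})^{\circ}=a$. $\mathbb{K}$ is a field of characteristic $0$ equipped with an involution $\circ$ (possibly trivial). $L$ is a commutative $\mathbb{K}$-algebra that is an involutive algebra over $\mathbb{K}$, i.e. it has an involution, also written $\circ$, with $(ra)^{\circ}=r^{\circ}a^{\circ}$ for $r\in\mathbb{K}$, $a\in L$. $R=\mathbb{K}[x_1,\dots,x_n]$ is a polynomial ring and $R\subseteq L$ is a $\mathbb{K}$-subalgebra. $\{R_{\le d}\}_{d\in\mathbb{N}}$ is a fixed filtration of $R$ by finite-dimensional $\mathbb{K}$-vector subspaces: $R_{\le d}\subseteq R_{\le e}$ for $d\le e$, $R=\bigcup_d R_{\le d}$, $1\in R_{\le 0}$, and $R_{\le d}\cdot R_{\le e}\subseteq R_{\le d+e}$. A map $f$ of $\mathbb{K}$-vector spaces is semilinear if it is additive and $f(ra)=r^{\circ}f(a)$ for $r\in\mathbb{K}$; $\mathrm{Hom}^{\mathrm{semi}}_{\mathbb{K}}(V,\mathbb{K})$ is the space of semilinear maps $V\to\mathbb{K}$. For a $\mathbb{K}$-linear $\sigma\colon L\to\mathbb{K}$, put $\langle q,p\rangle_\sigma:=\sigma(q^{\circ}p)$ for $q,p\in L$. For an ideal $\mathfrak{b}\subseteq L$, $\mathfrak{b}^{\circ}=\{b^{\circ}: b\in\mathfrak{b}\}$; $\pi_{\mathfrak{b}}\colon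 R\to R/(\mathfrak{b}\cap R)$ and $\pi_{\mathfrak{b},\le d}\colon R_{\le d}\to R_{\le d}/(\mathfrak{b}\cap R_{\le d})$ denote the quotient maps. *)

(* Defs.v *)
(* Mathematical Components, with the classical axioms of mathcomp.classical. *)
From HB Require Import structures.
From mathcomp Require Import all_boot all_order all_algebra.
From mathcomp Require Import boolp.
From mathcomp Require Import mpoly.

Set Implicit Arguments.
Unset Strict Implicit.
Unset Printing Implicit Defensive.

Import GRing.Theory.
Local Open Scope ring_scope.

(* On commutative rings (ab)° = b°a° says that ° is a ring morphism.  With
   s := conj \; *:%R, the linearity below is (r a + b)° = r° a° + b°. *)
#[short(type="involutive_lrmorphism")]
HB.structure Definition InvolutiveLRMorphism (K : fieldType)
    (L : comAlgType K) (s : K -> L -> L) :=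
  {f of @GRing.LRMorphism K L L s f & @isInvolutive L f}.

Definition fin_dim (K : fieldType) (V : lmodType K) : Prop :=
  exists m, inhabited (Vector.axiom m V).

Section Subspaces.
Variables (K : fieldType) (V : lmodType K) (W : submodClosed V).

Definition subspace := {v : V | v \in W}.
HB.instance Definition _ := SubType.on subspace.
HB.instance Definition _ := Choice.on subspace.
HB.instance Definition _ :=
  [SubChoice_isSubLmodule of subspace by <:].

(* submodClosed does not inherit from zmodClosed, which the quotients of
   ring_quotient require. *)
Definition submod_pred : {pred V} := [pred v | v \in W].

Fact submod_pred_closed : subsemimod_closed submod_pred.
Proof. exact: GRing.subsemimodClosedP. Qed.
HB.instance Definition _ :=
  GRing.isSubmodClosed.Build K V submod_pred submod_pred_closed.

Definition lquot := Quotient.quot submod_pred.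
HB.instance Definition _ := GRing.Zmodule.on lquot.

Definition lquot_pi (v : V) : lquot := \pi_(Quotient.quot submod_pred)%qT v.

Fact lquot_pi_is_zmod_morphism : zmod_morphism lquot_pi.
Proof. exact: raddfB. Qed.
HB.instance Definition _ :=
  GRing.isZmodMorphism.Build V lquot lquot_pi lquot_pi_is_zmod_morphism.

Lemma lquot_piE (u v : V) : (lquot_pi u == lquot_pi v) = (u - v \in W).
Proof. by rewrite -(Quotient.idealrBE submod_pred). Qed.

Lemma lquot_repr (x : lquot) : lquot_pi (repr x) = x.
Proof. exact: reprK. Qed.

Definition lquot_scale (r : K) (x : lquot) : lquot := lquot_pi (r *: repr x).

Lemma lquot_scale_pi r v : lquot_scale r (lquot_pi v) = lquot_pi (r *: v).
Proof.
by apply/eqP; rewrite lquot_piE -scalerBr rpredZ // -lquot_piE lquot_repr.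
Qed.

Fact lquot_scaleA r s x :
  lquot_scale r (lquot_scale s x) = lquot_scale (r * s) x.
Proof. by rewrite -[x]lquot_repr !lquot_scale_pi scalerA. Qed.
Fact lquot_scale1 : left_id 1 lquot_scale.
Proof. by move=> x; rewrite -[x]lquot_repr !lquot_scale_pi scale1r. Qed.
Fact lquot_scaleDr : right_distributive lquot_scale +%R.
Proof.
move=> r x y; rewrite -[x]lquot_repr -[y]lquot_repr -raddfD.
by rewrite !lquot_scale_pi -raddfD scalerDr.
Qed.
Fact lquot_scaleDl x : {morph lquot_scale^~ x : r s / r + s}.
Proof.
by move=> r s; rewrite -[x]lquot_repr !lquot_scale_pi -raddfD scalerDl.
Qed.
HB.instance Definition _ := GRing.Zmodule_isLmodule.Build K lquot
  lquot_scaleA lquot_scale1 lquot_scaleDr lquot_scaleDl.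

Fact lquot_pi_scalable : scalable lquot_pi.
Proof. by move=> r v; rewrite -lquot_scale_pi. Qed.
HB.instance Definition _ :=
  GRing.isScalable.Build K V lquot *:%R lquot_pi lquot_pi_scalable.

End Subspaces.

Section SemiHom.
Variables (K : fieldType) (conj : involutive_rmorphism K) (V : lmodType K).

Definition semi_hom := {linear V -> K | conj \; *%R}.

HB.instance Definition _ := gen_eqMixin semi_hom.
HB.instance Definition _ := gen_choiceMixin semi_hom.

Implicit Types f g h : semi_hom.

Lemma semi_hom_ext f g : (forall v, f v = g v) -> f = g.
Proof.
case: f g => [f [fA fS]] [g [gA gS]] /= /funext eq_fg.
case: _ / eq_fg in gA gS *.
case: fA gA => fA [gA]. case: fS gS => fS [gS].
by rewrite (Prop_irrelevance fA gA) (Prop_irrelevance fS gS).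
Qed.

Definition semi_hom_scale_fun r f (v : V) : K := r * f v.
Fact semi_hom_scale_linear r f :
  linear_for (conj \; *%R) (semi_hom_scale_fun r f).
Proof.
move=> a u v; rewrite /semi_hom_scale_fun linearP mulrDr /=.
by rewrite mulrCA.
Qed.
HB.instance Definition _ r f := GRing.isLinear.Build K V K (conj \; *%R)
  (semi_hom_scale_fun r f) (semi_hom_scale_linear r f).

Definition semi_hom_zero : semi_hom := \0.
Definition semi_hom_opp f : semi_hom := \- f.
Definition semi_hom_add f g : semi_hom := f \+ g.
Definition semi_hom_scale r f : semi_hom := semi_hom_scale_fun r f.

Fact semi_hom_addA : associative semi_hom_add.
Proof. by move=> f g h; apply: semi_hom_ext => v /=; rewrite addrA. Qed.
Fact semi_hom_addC : commutative semi_hom_add.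
Proof. by move=> f g; apply: semi_hom_ext => v /=; rewrite addrC. Qed.
Fact semi_hom_add0 : left_id semi_hom_zero semi_hom_add.
Proof. by move=> f; apply: semi_hom_ext => v /=; rewrite add0r. Qed.
Fact semi_hom_addN : left_inverse semi_hom_zero semi_hom_opp semi_hom_add.
Proof. by move=> f; apply: semi_hom_ext => v /=; rewrite addNr. Qed.
HB.instance Definition _ := GRing.isZmodule.Build semi_hom
  semi_hom_addA semi_hom_addC semi_hom_add0 semi_hom_addN.

Fact semi_hom_scaleA r s f :
  semi_hom_scale r (semi_hom_scale s f) = semi_hom_scale (r * s) f.
Proof. by apply: semi_hom_ext => v; apply: mulrA. Qed.
Fact semi_hom_scale1 : left_id 1 semi_hom_scale.
Proof. by move=> f; apply: semi_hom_ext => v; apply: mul1r. Qed.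
Fact semi_hom_scaleDr : right_distributive semi_hom_scale +%R.
Proof. by move=> r f g; apply: semi_hom_ext => v; apply: mulrDr. Qed.
Fact semi_hom_scaleDl f : {morph semi_hom_scale^~ f : r s / r + s}.
Proof. by move=> r s; apply: semi_hom_ext => v; apply: mulrDl. Qed.
HB.instance Definition _ := GRing.Zmodule_isLmodule.Build K semi_hom
  semi_hom_scaleA semi_hom_scale1 semi_hom_scaleDr semi_hom_scaleDl.

End SemiHom.

Section QuotientTranspose.
Variables (K : fieldType) (conj : involutive_rmorphism K).
Variables (V : lmodType K) (W : submodClosed V).

Definition lquot_tr (phi : semi_hom conj (lquot W)) : semi_hom conj V :=
  phi \o lquot_pi W.

Fact lquot_tr_linear : linear lquot_tr.
Proof. by move=> r phi psi; apply: semi_hom_ext. Qed.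
HB.instance Definition _ := GRing.isLinear.Build K
  (semi_hom conj (lquot W)) (semi_hom conj V) *:%R lquot_tr lquot_tr_linear.

End QuotientTranspose.

Section Hankel.
Variables (K : fieldType) (conj : involutive_rmorphism K) (L : comAlgType K).
Variable star : involutive_lrmorphism (conj \; *:%R : K -> L -> L).

Lemma starZ r (x : L) : star (r *: x) = conj r *: star x.
Proof. exact: (linearZ_LR star). Qed.

(* Ideals of L are the L-submodules of L^o; the idealr structure of
   ring_quotient would exclude the improper ideal. *)
Definition conj_ideal (a : submodClosed L^o) : {pred L^o} :=
  fun x => `[< exists2 b : L, b \in a & x = star b >].

Fact conj_ideal_closed a : subsemimod_closed (conj_ideal a).
Proof.
split; first split.
- by apply/asboolP; exists 0; [exact: rpred0 | rewrite rmorph0].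
- move=> _ _ /asboolP[u ua ->] /asboolP[v va ->].
  by apply/asboolP; exists (u + v); [exact: rpredD | rewrite rmorphD].
- move=> x _ /asboolP[u ua ->]; apply/asboolP; exists (star (x : L) * u).
    exact: (@rpredZ _ _ a (star (x : L)) u ua).
  by rewrite rmorphM; congr (_ * _); exact/esym/(rmorphK star).
Qed.
HB.instance Definition _ a := GRing.isSubmodClosed.Build L L^o
  (conj_ideal a) (conj_ideal_closed a).

(* For f the inclusion of a K-subspace U of L, this is the intersection of
   the ideal b with U. *)
Definition ideal_cap (U : lmodType K) (f : {linear U -> L})
  (b : submodClosed L^o) : {pred U} := fun u => f u \in b.

Fact ideal_cap_closed U f b : subsemimod_closed (@ideal_cap U f b).
Proof.
split; [split=> [|u v ub vb] | move=> r u ub].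
- by change (f 0 \in b); rewrite linear0; apply: rpred0.
- by change (f (u + v) \in b); rewrite linearD; apply: rpredD.
change (f (r *: u) \in b); rewrite linearZ /= -mulr_algl.
exact: (@rpredZ _ _ b r%:A (f u) ub).
Qed.
HB.instance Definition _ U f b := GRing.isSubmodClosed.Build K U
  (@ideal_cap U f b) (ideal_cap_closed f b).

Definition sprod (sigma : {scalar L}) (q p : L) : K := sigma (star q * p).

Variables (U V : lmodType K) (f : {linear U -> L}) (g : {linear V -> L}).
Variable sigma : {scalar L}.

Definition hankel_row (p : U) (q : V) : K := sprod sigma (g q) (f p).

Fact hankel_row_semilinear p : linear_for (conj \; *%R) (hankel_row p).
Proof.
move=> r u v; rewrite /hankel_row /sprod linearP raddfD /= starZ.
by rewrite mulrDl -scalerAl linearP.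
Qed.
HB.instance Definition _ p := GRing.isLinear.Build K V K (conj \; *%R)
  (hankel_row p) (hankel_row_semilinear p).

(* With f and g the inclusions of U and V in L: p |-> (q |-> <q, p>). *)
Definition hankel (p : U) : semi_hom conj V := hankel_row p.

Fact hankel_linear : linear hankel.
Proof.
move=> r u v; apply: semi_hom_ext => q /=.
by rewrite /hankel_row /sprod linearP mulrDr -scalerAr linearP.
Qed.
HB.instance Definition _ :=
  GRing.isLinear.Build K U (semi_hom conj V) *:%R hankel hankel_linear.

End Hankel.

Record is_filtration (K : fieldType) (A : comAlgType K)
    (F : nat -> submodClosed A) : Prop := IsFiltration {
  filt_fin_dim : forall d, fin_dim (subspace (F d));
  filt_sub : forall d e, (d <= e)%N -> {subset F d <= F e};
  filt_cover : forall p, exists d, p \in F d;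
  filt_one : 1 \in F 0%N;
  filt_mul : forall d e p q, p \in F d -> q \in F e -> p * q \in F (d + e)%N
}.

(* Main.v *)
Require Import Defs.
From HB Require Import structures.
From mathcomp Require Import all_boot all_order all_algebra.
From mathcomp Require Import boolp.
From mathcomp Require Import mpoly.

Set Implicit Arguments.
Unset Strict Implicit.
Unset Printing Implicit Defensive.

Import GRing.Theory.
Local Open Scope ring_scope.

(** The pairing of p and q is sigma (star q * p), and sigma kills the ideal a.
    If p lies in a, then so does star q * p.  If q lies in the conjugate ideal,
    say q = star b with b in a, then star q = b, and again star q * p lies in
    a.  Hence the pairing vanishes when either argument lies in its respective
    ideal ([sprod_eq0l], [sprod_eq0r]), and it descends to the two quotients
    one variable at a time.

    The argument is insensitive to which subspaces of L the variables range
    over, so [hankel_factor] is stated for two linear maps f and g into L; the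
    full and the truncated factorizations are both instances of it.

    The semilinear forms on a finite-dimensional space again form a
    finite-dimensional space ([fin_dim_semi_hom]), by the dual basis. *)

(** * Descent to quotients *)

(** Stated for an arbitrary scaling law [s], because it is applied both to
    linear maps and to semilinear forms. *)
Lemma lquot_factor (K : fieldType) (V : lmodType K) (W : submodClosed V)
    (Z : zmodType) (s : K -> Z -> Z) (f : {linear V -> Z | s}) :
  (forall v, v \in W -> f v = 0) ->
  exists g : {linear lquot W -> Z | s}, forall v, g (lquot_pi W v) = f v.
Proof.
move=> f0; pose g (x : lquot W) := f (repr x).
have g_pi v : g (lquot_pi W v) = f v.
  apply/subr0_eq; rewrite -raddfB; apply: f0.
  by rewrite -lquot_piE lquot_repr.
have g_add : zmod_morphism g.
  move=> x y; rewrite -[x]lquot_repr -[y]lquot_repr -raddfB.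
  by rewrite !g_pi raddfB.
have g_scale : scalable_for s g.
  move=> r x; rewrite -[x]lquot_repr -linearZ.
  by rewrite !g_pi linearZ_LR.
pose gA := GRing.isZmodMorphism.Build _ _ g g_add.
pose gS := GRing.isScalable.Build _ _ _ s g g_scale.
pose gL : {linear lquot W -> Z | s} := HB.pack g gA gS.
by exists gL.
Qed.

Lemma lquot_tr_inj (K : fieldType) (conj : involutive_rmorphism K)
    (V : lmodType K) (W : submodClosed V) :
  injective (@lquot_tr K conj V W).
Proof.
move=> phi psi eq_tr; apply: semi_hom_ext => x; rewrite -[x]lquot_repr.
exact: (congr1 (fun h : semi_hom conj V => h (repr x)) eq_tr).
Qed.

(** A map into semilinear forms is a sesquilinear form.  Descending each form
    gives a map into the forms on the quotient by [W2]; it is again linear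
    because [lquot_tr] is linear and injective, so it descends in turn. *)
Lemma lquot_factor2 (K : fieldType) (conj : involutive_rmorphism K)
    (U V : lmodType K) (W1 : submodClosed U) (W2 : submodClosed V)
    (h : {linear U -> semi_hom conj V}) :
  (forall u v, u \in W1 -> h u v = 0) ->
  (forall u v, v \in W2 -> h u v = 0) ->
  exists hbar : {linear lquot W1 -> semi_hom conj (lquot W2)},
    forall u v, hbar (lquot_pi W1 u) (lquot_pi W2 v) = h u v.
Proof.
move=> h0l h0r.
have /choice[k kP] u : exists k : semi_hom conj (lquot W2),
    forall v, k (lquot_pi W2 v) = h u v.
  by apply: lquot_factor => v; apply: h0r.
have tr_k u : lquot_tr (k u) = h u by apply: semi_hom_ext => v; apply: kP.
have k_lin : linear k.
  move=> r u v; apply: lquot_tr_inj; rewrite tr_k linearP -!tr_k.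
  exact/esym/linearP.
pose kM := GRing.isLinear.Build _ _ _ _ k k_lin.
pose kL : {linear U -> semi_hom conj (lquot W2)} := HB.pack k kM.
have [u uW1|hbar hbarP] := @lquot_factor K U W1 _ _ kL.
  apply: lquot_tr_inj; rewrite tr_k.
  by apply: semi_hom_ext => v; apply: h0l.
by exists hbar => u v; rewrite hbarP kP.
Qed.

(** * The pairing modulo the ideal *)

Section Pairing.
Variables (K : fieldType) (conj : involutive_rmorphism K) (L : comAlgType K).
Variable star : involutive_lrmorphism (conj \; *:%R : K -> L -> L).
Variables (a : submodClosed L^o) (sigma : {scalar L}).
Hypothesis sigma0 : forall x : L, x \in a -> sigma x = 0.

Lemma sprod_eq0r (q p : L) : p \in a -> sprod star sigma q p = 0.
Proof. by move=> pa; apply/sigma0/(@rpredZ _ _ a (star q) p pa). Qed.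

Lemma sprod_eq0l (q p : L) :
  q \in conj_ideal star a -> sprod star sigma q p = 0.
Proof.
case/asboolP=> b ba ->; rewrite /sprod.
have -> : star (star b) = b by exact: (rmorphK star).
by rewrite mulrC; apply/sigma0/(@rpredZ _ _ a p b ba).
Qed.

Lemma hankel_factor (U V : lmodType K) (f : {linear U -> L})
    (g : {linear V -> L}) :
  let W1 := ideal_cap f a in
  let W2 := ideal_cap g (conj_ideal star a) in
  exists Hbar : {linear lquot W1 -> semi_hom conj (lquot W2)},
    (forall p q, Hbar (lquot_pi W1 p) (lquot_pi W2 q)
       = sprod star sigma (g q) (f p))
    /\ hankel star f g sigma =1 lquot_tr (W := W2) \o Hbar \o lquot_pi W1.
Proof.
move=> W1 W2.
have [u v uW|u v vW|Hbar HbarP] :=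
    @lquot_factor2 K conj U V W1 W2 (hankel star f g sigma).
- exact: sprod_eq0r.
- exact: sprod_eq0l.
exists Hbar; split=> [p q|p]; first exact: HbarP.
by apply: semi_hom_ext => q; apply/esym/HbarP.
Qed.

End Pairing.

(** * Semilinear forms on a finite-dimensional space *)

(** A semilinear form is determined by its values on a basis, and any values
    [w_j] are attained, by the form sending [v] to the sum of
    [conj (v_j) * w_j]. *)
Lemma fin_dim_semi_hom (K : fieldType) (conj : involutive_rmorphism K)
    (V : lmodType K) :
  fin_dim V -> fin_dim (semi_hom conj V).
Proof.
case=> m [[c c_lin [c' cK c'K]]].
exists m; constructor.
pose b j := c' (delta_mx 0 j).
pose coord (f : semi_hom conj V) : 'rV[K]_m := \row_j f (b j).
pose form (w : 'rV[K]_m) (v : V) := \sum_j conj (c v 0 j) * w 0 j.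
have form_lin w : linear_for (conj \; *%R) (form w).
  move=> r u v; rewrite /form /= mulr_sumr -big_split; apply: eq_bigr => j _ /=.
  by rewrite c_lin !mxE rmorphD rmorphM mulrDl mulrA.
pose formL w : semi_hom conj V :=
  HB.pack (form w) (GRing.isLinear.Build _ _ _ _ (form w) (form_lin w)).
pose cL : {linear V -> 'rV[K]_m} :=
  HB.pack c (GRing.isLinear.Build _ _ _ _ c c_lin).
have v_sum v : v = \sum_j c v 0 j *: b j.
  apply: (can_inj cK); rewrite -[RHS]/(cL _) linear_sum [LHS]row_sum_delta.
  by apply: eq_bigr => j _; rewrite linearZ /= c'K.
exists coord.
  by move=> r f g; apply/rowP=> j; rewrite !mxE.
exists formL => [f|w].
  apply: semi_hom_ext => v; rewrite [in RHS](v_sum v) linear_sum.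
  by apply: eq_bigr => j _; rewrite linearZ_LR mxE.
apply/rowP=> j; rewrite mxE /= /form c'K (bigD1 j) //= big1 => [|i neq_ij].
  by rewrite mxE !eqxx rmorph1 mul1r addr0.
by rewrite mxE (negPf neq_ij) andbF rmorph0 mul0r.
Qed.

(** * The factorizations *)

Theorem theorem3p2 (K : fieldType) (conj : involutive_rmorphism K)
    (L : comAlgType K)
    (star : involutive_lrmorphism (conj \; *:%R : K -> L -> L))
    (n : nat) (iota : {lrmorphism {mpoly K[n]} -> L})
    (F : nat -> submodClosed {mpoly K[n]})
    (a : submodClosed L^o) (sigma : {scalar L}) :
  [pchar K] =i pred0 ->
  injective iota ->
  is_filtration F ->
  (forall x : L, x \in a -> sigma x = 0) ->
  let aR := ideal_cap iota a in
  let aoR := ideal_cap iota (conj_ideal star a) in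
  let H : {linear {mpoly K[n]} -> semi_hom conj {mpoly K[n]}} :=
    hankel star iota iota sigma in
  (exists Hbar : {linear lquot aR -> semi_hom conj (lquot aoR)},
      (forall p q : {mpoly K[n]},
          Hbar (lquot_pi aR p) (lquot_pi aoR q)
          = sprod star sigma (iota q) (iota p))
      /\ H =1 lquot_tr (W := aoR) \o Hbar \o lquot_pi aR)
  /\
  (forall d delta : nat,
      let incl e := iota \o (val : subspace (F e) -> {mpoly K[n]}) in
      let ad := ideal_cap (incl d) a in
      let aod := ideal_cap (incl (d + delta)%N) (conj_ideal star a) in
      let Hd : {linear subspace (F d) ->
                  semi_hom conj (subspace (F (d + delta)%N))} :=
        hankel star (incl d) (incl (d + delta)%N) sigma in
      [/\ fin_dim (subspace (F d)),
          fin_dim (semi_hom conj (subspace (F (d + delta)%N)))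
        & exists Hbar : {linear lquot ad -> semi_hom conj (lquot aod)},
            (forall (p : subspace (F d)) (q : subspace (F (d + delta)%N)),
                Hbar (lquot_pi ad p) (lquot_pi aod q)
                = sprod star sigma (iota (val q)) (iota (val p)))
            /\ Hd =1 lquot_tr (W := aod) \o Hbar \o lquot_pi ad]).
Proof.
move=> _ _ [F_fin _ _ _ _] sigma0; split; first exact: hankel_factor.
move=> d delta; split; [exact: F_fin | exact: fin_dim_semi_hom |].
exact: hankel_factor.
Qed.
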